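(* Let $W^*$ be a stationary solution of the balance law $W_t+F(W)_x=S(W)H_x+R(W)$, and let $W_i^1$, $i=1,\dots,N_x$, be its cell-averages (or their approximations by the mid-point rule). Suppose that the full-order model (FOM) $$W_i^{n+1}=W_i^n-\frac{\Delta t}{\Delta x}\,\mathcal{L}\left(W_{i-1}^n,W_i^n,W_{i+1}^n\right),\qquad i=1,\dots,N_x,$$ is well-balanced for $W^*$, i.e. the FOM solution started from the initial data $\{W_i^1\}$ satisfies $W_i^n=W_i^1$ for all $i$ and all $n$. Then the associated POD-Galerkin reduced-order model (ROM) (built from the snapshots of this FOM solution, as described in the context) is also well-balanced for $W^*$: its solution $Wr_i^n=(wr_{1,i}^n,\dots,wr_{N,i}^n)^T$ satisfies $$wr_{j,i}^n=wr_{j,i}^1=w_{j,i}^1\qquad\text{for all } j=1,\dots,N,\ i=1,\dots,N_x,\text{ and all } n,$$ where $w_{j,i}^1$ is the $j$-th component of $W_i^1$.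
   Context: **Balance law.** $I\subset\mathbb{R}$ is an interval, $\Omega\subset\mathbb{R}^N$ is an open convex set, $F,S,R:\Omega\to\mathbb{R}^N$ are functions ($F$ regular), and $H:I\to\mathbb{R}$ is a known bounded function. The unknown $W=(w_1,\dots,w_N)^T$ takes values in $\Omega$ and satisfies $W_t+F(W)_x=S(W)H_x+R(W)$. A stationary solution is a time-independent $W^*$ with $F(W^* )_x=S(W^* )H_x+R(W^* )$. **Full-order model (FOM).** $I$ is divided into $N_x$ cells $I_i=[x_{i-1/2},x_{i+1/2}]$ of uniform size $\Delta x$; $\Delta t>0$ is the time step and $t^n=(n-1)\Delta t$, $n=1,\dots,N_T$. $W_i^n=(w_{1,i}^n,\dots,w_{N,i}^n)^T\in\Omega$ approximates the average of $W(\cdot,t^n)$ over $I_i$. The FOM is an explicit first-order finite volume scheme given by an arbitrary function $\mathcal{L}=(\mathcal{L}_1,\dots,\mathcal{L}_N)^T:\Omega^3\to\mathbb{R}^N$, as displayed in the claim. The values $W_0^n$ and $W_{N_x+1}^n$ needed in the first and last cells are given by a fixed boundary rule, i.e. as fixed functions (with values in $\Omega$) of $(W_1^n,\dots,W_{N_x}^n)$; the same rule is used for the FOM and the ROM. **Well-balancedness.** A numerical method is (exactly) well-balanced for $W^*$ if the sequence of cell-averages of $W^*$ (or of their quadrature approximations) is an equilibrium of the method, i.e. is left unchanged by the time stepping. **Associated POD-Galerkin ROM.** For each component $j=1,\dots,N$ let $M_{w_j}\in\mathbb{R}^{N_x\times N_T}$ be the snapshot matrix with entries $(M_{w_j})_{i,n}=w_{j,i}^n$,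 where $w_{j,i}^n$ is the FOM solution. Let $\Phi_{j,1},\dots,\Phi_{j,N_x}$, with $\Phi_{j,k}=(\Phi_{j,1,k},\dots,\Phi_{j,N_x,k})^T$, be an orthonormal basis of $\mathbb{R}^{N_x}$ of eigenvectors of $M_{w_j}M_{w_j}^T$ ordered by decreasing eigenvalues, i.e. left singular vectors of $M_{w_j}$ ordered by decreasing singular values. Let $M$ be the number of retained POD modes, $1\le M\le\min\{N_x,N_T\}$ (for instance, the smallest $M$ with $\sum_{i=1}^M\sigma_i^2\ge(1-\varepsilon_{\mathrm{POD}}^2)\sum_{i=1}^r\sigma_i^2$, where $\sigma_1\ge\dots\ge\sigma_r$ are the singular values and $\varepsilon_{\mathrm{POD}}\in(0,1)$ is a tolerance). The ROM solution has the form $$wr_{j,i}^n=\sum_{k=1}^M\hat w_{j,k}^n\,\Phi_{j,i,k},\qquad Wr_i^n=(wr_{1,i}^n,\dots,wr_{N,i}^n)^T.$$ The initial coefficients are obtained by projecting the FOM initial data onto the POD basis, $\hat w_{j,p}^1=\sum_{i=1}^{N_x}w_{j,i}^1\Phi_{j,i,p}$. The coefficients are then updated by $$\hat w_{j,p}^{n+1}=\hat w_{j,p}^n-\frac{\Delta t}{\Delta x}\sum_{i=1}^{N_x}\mathcal{L}_j\left(Wr_{i-1}^n,Wr_i^n,Wr_{i+1}^n\right)\Phi_{j,i,p},\qquad p=1,\dots,M,\ j=1,\dots,N.$$ The recursion is well defined as long as the states $Wr_i^n$ lie in $\Omega$. *)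

(* Defs.v *)
From HB Require Import structures.
From mathcomp Require Import all_boot all_order all_algebra.
From mathcomp Require Import all_classical all_reals all_analysis.

Set Implicit Arguments.
Unset Strict Implicit.
Unset Printing Implicit Defensive.

Import Order.TTheory GRing.Theory Num.Theory.
Import numFieldNormedType.Exports.

Local Open Scope classical_set_scope.
Local Open Scope ring_scope.

(* Vectors of R^N are row vectors.  Functions defined on Omega (resp. on I) are
   total functions, and only their values on Omega (resp. on I) are meant to
   matter.  Cells and time levels are numbered from 0: i : 'I_Nx is the cell
   number i + 1 of the usual numbering 1, ..., Nx, and n : nat is the time
   level n + 1, so that index n = 0 is the initial time t^1 = 0. *)

Section BalanceLaw.
Context {R : realType} {N : nat}.
Implicit Types (I : set R) (Omega : set 'rV[R]_N).

Definition C1_on Omega (F : 'rV[R]_N -> 'rV[R]_N) : Prop :=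
  forall w, Omega w ->
    differentiable F w /\
    forall v : 'rV[R]_N, {for w, continuous (fun z => 'd F z v)}.

(* F(W)_x = S(W) H_x + R(W), componentwise, in the classical sense: F \o W and
   H, but not necessarily W itself, have to be derivable inside I. *)
Definition stationary_solution I Omega (F S Rs : 'rV[R]_N -> 'rV[R]_N)
    (H : R -> R) (W : R -> 'rV[R]_N) : Prop :=
  (forall x, I x -> Omega (W x)) /\
  (forall x, interior I x ->
     derivable H x 1 /\
     forall j : 'I_N,
       derivable (fun y => F (W y) 0 j) x 1 /\
       derive1 (fun y => F (W y) 0 j) x =
         S (W x) 0 j * derive1 H x + Rs (W x) 0 j).

End BalanceLaw.

Section Mesh.
Context {R : realType} {N : nat}.
Variables (Nx : nat) (xl dx : R).

Definition cell (i : 'I_Nx) : set R :=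
  `[xl + i%:R * dx, xl + i.+1%:R * dx]%classic.

Definition cell_center (i : 'I_Nx) : R := xl + (i%:R + 2^-1) * dx.

(* Row i of W0 is the average of W over cell i. *)
Definition cell_averages (W : R -> 'rV[R]_N) (W0 : 'M[R]_(Nx, N)) : Prop :=
  forall (i : 'I_Nx) (j : 'I_N),
    lebesgue_measure.-integrable (cell i) (fun x => (W x 0 j)%:E) /\
    W0 i j = dx^-1 * Rintegral lebesgue_measure (cell i) (fun x => W x 0 j).

Definition midpoint_averages (W : R -> 'rV[R]_N) (W0 : 'M[R]_(Nx, N)) : Prop :=
  forall i : 'I_Nx, row i W0 = W (cell_center i).

End Mesh.

Section Schemes.
Context {R : realType} {N Nx : nat}.
Variables (L : 'rV[R]_N -> 'rV[R]_N -> 'rV[R]_N -> 'rV[R]_N).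
Variables (bl br : 'M[R]_(Nx, N) -> 'rV[R]_N).
Variables (dt dx : R).

(* The state in the cell number k, numbered from 1; bl and br give the ghost
   values in the cells 0 and Nx + 1 as functions of the interior values. *)
Definition ghosted (W : 'M[R]_(Nx, N)) (k : nat) : 'rV[R]_N :=
  if k is k'.+1 then
    if insub k' is Some i then row i W else br W
  else bl W.

Definition L_at (W : 'M[R]_(Nx, N)) (i : 'I_Nx) : 'rV[R]_N :=
  L (ghosted W i) (ghosted W i.+1) (ghosted W i.+2).

Definition fom_step (W : 'M[R]_(Nx, N)) : 'M[R]_(Nx, N) :=
  \matrix_(i, j) (W i j - dt / dx * L_at W i 0 j).

Definition fom (W0 : 'M[R]_(Nx, N)) (n : nat) : 'M[R]_(Nx, N) :=
  iter n fom_step W0.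

Definition snapshots (W : nat -> 'M[R]_(Nx, N)) (NT : nat) (j : 'I_N) :
    'M[R]_(Nx, NT) :=
  \matrix_(i, n) W n i j.

(* The columns of Phi form an orthonormal basis of R^Nx of eigenvectors of
   A A^T, ordered by decreasing eigenvalues. *)
Definition pod_basis (NT : nat) (A : 'M[R]_(Nx, NT)) (Phi : 'M[R]_Nx) : Prop :=
  Phi^T *m Phi = 1%:M /\
  exists lam : 'I_Nx -> R,
    (forall k l : 'I_Nx, (k <= l)%N -> lam l <= lam k) /\
    (forall k : 'I_Nx, A *m A^T *m col k Phi = lam k *: col k Phi).

Section Rom.
Context {M : nat}.
Variables (leM : (M <= Nx)%N) (Phi : 'I_N -> 'M[R]_Nx).

(* Phi_(j,i,k), for the retained modes k < M only *)
Definition mode (j : 'I_N) (i : 'I_Nx) (k : 'I_M) : R :=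
  Phi j i (widen_ord leM k).

Definition rom_state (c : 'M[R]_(N, M)) : 'M[R]_(Nx, N) :=
  \matrix_(i, j) \sum_(k < M) c j k * mode j i k.

Definition rom_init (W0 : 'M[R]_(Nx, N)) : 'M[R]_(N, M) :=
  \matrix_(j, p) \sum_(i < Nx) W0 i j * mode j i p.

Definition rom_step (c : 'M[R]_(N, M)) : 'M[R]_(N, M) :=
  \matrix_(j, p)
    (c j p - dt / dx * \sum_(i < Nx) L_at (rom_state c) i 0 j * mode j i p).

Definition rom (W0 : 'M[R]_(Nx, N)) (n : nat) : 'M[R]_(Nx, N) :=
  rom_state (iter n rom_step (rom_init W0)).

End Rom.

End Schemes.

(* Main.v *)
(** The FOM solution is constant in time, so each snapshot matrix is [w 1^T], of
    rank at most one, and [A A^T = NT w w^T].  Hence [w] is orthogonal to every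
    POD mode except possibly the first, and its projection onto [M >= 1] modes
    is exact.  Since well-balancedness forces the flux differences [L_at W1] to
    vanish, the ROM coefficients never move. *)

Require Import Defs.
From HB Require Import structures.
From mathcomp Require Import all_boot all_order all_algebra.
From mathcomp Require Import all_classical all_reals all_analysis.

Set Implicit Arguments.
Unset Strict Implicit.
Unset Printing Implicit Defensive.

Import Order.TTheory GRing.Theory Num.Theory.
Import numFieldNormedType.Exports.

Local Open Scope classical_set_scope.
Local Open Scope ring_scope.

Lemma pod_basis_gram (R : realType) (Nx NT : nat) (A : 'M[R]_(Nx, NT))
    (Phi : 'M[R]_Nx) (lam : 'I_Nx -> R) :
  Phi^T *m Phi = 1%:M ->
  (forall k, A *m A^T *m col k Phi = lam k *: col k Phi) ->
  forall l k, (Phi^T *m (A *m A^T) *m Phi) l k = lam k *+ (l == k).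
Proof.
move=> orthoPhi eigPhi l k.
have -> : (Phi^T *m (A *m A^T) *m Phi) l k
    = (Phi^T *m (A *m A^T *m col k Phi)) l 0.
  by rewrite colE !mulmxA -colE [RHS]mxE.
by rewrite eigPhi -scalemxAr colE mulmxA orthoPhi mul1mx !mxE eqxx andbT mulr_natr.
Qed.

(** With [c = Phi^T w], the diagonal matrix [Phi^T A A^T Phi] equals [NT c c^T], so at most one
    entry of [c] is nonzero; the ordering of the eigenvalues [NT c_k^2] puts it first. *)
Lemma pod_basis_rank1 (R : realType) (Nx NT : nat) (w : 'cV[R]_Nx)
    (Phi : 'M[R]_Nx) :
  (0 < NT)%N -> pod_basis (w *m const_mx 1 : 'M[R]_(Nx, NT)) Phi ->
  forall k : 'I_Nx, (0 < k)%N -> (Phi^T *m w) k 0 = 0.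
Proof.
move=> NT_gt0 [orthoPhi [lam [lam_mono eigPhi]]] k k_gt0.
have NTr_gt0 : 0 < NT%:R :> R by rewrite ltr0n.
have gram l m :
    (Phi^T *m w) l 0 * (Phi^T *m w) m 0 * NT%:R = lam m *+ (l == m).
  rewrite -(pod_basis_gram orthoPhi eigPhi) trmx_mul.
  have w1T : w *m const_mx 1 *m (const_mx 1 : 'rV[R]_NT)^T = NT%:R *: w.
    apply/matrixP=> i o; rewrite !mxE (eq_bigr (fun=> w i o)) => [|s _].
      by rewrite sumr_const card_ord mulr_natl.
    by rewrite !mxE big_ord1 !mxE !mulr1 (ord1 o).
  rewrite [w *m _ *m _]mulmxA w1T.
  rewrite -scalemxAl -scalemxAr -scalemxAl mulmxA -[_ *m w^T *m Phi]mulmxA.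
  have -> : w^T *m Phi = (Phi^T *m w)^T by rewrite trmx_mul trmxK.
  by rewrite [RHS]mxE [X in _ = _ * X]mxE big_ord1 [X in _ = _ * (_ * X)]mxE mulrC.
have Nx_gt0 : (0 < Nx)%N by apply: leq_ltn_trans (ltn_ord k).
pose o := Ordinal Nx_gt0.
have neq_ok : (o == k) = false.
  by apply/negbTE; rewrite -val_eqE /= neq_ltn k_gt0.
(* The off-diagonal entry gives [c_o c_k = 0]; only the case [c_o = 0] is left to treat. *)
have /eqP := gram o k; rewrite neq_ok mulr0n !mulf_eq0 (gt_eqF NTr_gt0) orbF.
case/orP=> /eqP // coef0.
(* Now [NT c_k^2 = lam k <= lam o = NT c_o^2 = 0]. *)
have := lam_mono o k (ltnW k_gt0).
have := gram o o; have := gram k k.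
rewrite !eqxx !mulr1n coef0 !mul0r => <- <- sq_le0.
apply/eqP; rewrite -sqrf_eq0 eq_le sqr_ge0 andbT expr2.
by rewrite -(pmulr_lle0 _ NTr_gt0).
Qed.

(** The full expansion in the basis [Phi j] is exact, and truncating it after [M] modes drops only
    zero terms. *)
Lemma rom_state_init (R : realType) (N Nx M : nat) (leM : (M <= Nx)%N)
    (Phi : 'I_N -> 'M[R]_Nx) (W : 'M[R]_(Nx, N)) :
  (forall j, (Phi j)^T *m Phi j = 1%:M) ->
  (forall j (k : 'I_Nx), (M <= k)%N -> ((Phi j)^T *m col j W) k 0 = 0) ->
  rom_state leM Phi (rom_init leM Phi W) = W.
Proof.
move=> orthoPhi tail0; apply/matrixP=> i j; rewrite mxE.
pose c := (Phi j)^T *m col j W.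
have coefE k : rom_init leM Phi W j k = c (widen_ord leM k) 0.
  by rewrite !mxE; apply: eq_bigr => s _; rewrite !mxE mulrC.
transitivity ((Phi j *m c) i 0); last first.
  (* Completeness: [Phi j] is square, so orthonormal columns also give [Phi j *m (Phi j)^T = 1]. *)
  by rewrite /c mulmxA (mulmx1C (orthoPhi j)) mul1mx mxE.
rewrite mxE (eq_bigr _ (fun k _ => congr1 (fun z => z * _) (coefE k))).
rewrite (bigID (fun k : 'I_Nx => (k < M)%N)) /= [X in _ + X]big1 ?addr0.
  rewrite (big_ord_narrow leM) /=.
  by apply: eq_bigr => k _; rewrite mulrC.
by move=> k; rewrite -leqNgt => /tail0 ck0; rewrite /c ck0 mulr0.
Qed.

Lemma fom_step_fixed (R : realType) (N Nx : nat)
    (L : 'rV[R]_N -> 'rV[R]_N -> 'rV[R]_N -> 'rV[R]_N)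
    (bl br : 'M[R]_(Nx, N) -> 'rV[R]_N) (dt dx : R) (W : 'M[R]_(Nx, N)) :
  dt / dx != 0 -> fom_step L bl br dt dx W = W ->
  forall i, L_at L bl br W i = 0.
Proof.
move=> dtx_neq0 fixW i; apply/rowP=> j; rewrite [RHS]mxE; apply/eqP.
move/matrixP/(_ i j)/eqP: fixW.
by rewrite mxE -subr_eq0 addrAC subrr add0r oppr_eq0 mulf_eq0 (negbTE dtx_neq0).
Qed.

Lemma rom_step_fixed (R : realType) (N Nx M : nat)
    (L : 'rV[R]_N -> 'rV[R]_N -> 'rV[R]_N -> 'rV[R]_N)
    (bl br : 'M[R]_(Nx, N) -> 'rV[R]_N) (dt dx : R)
    (leM : (M <= Nx)%N) (Phi : 'I_N -> 'M[R]_Nx) (c : 'M[R]_(N, M)) :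
  (forall i, L_at L bl br (rom_state leM Phi c) i = 0) ->
  rom_step L bl br dt dx leM Phi c = c.
Proof.
move=> L0; apply/matrixP=> j p; rewrite mxE big1 ?mulr0 ?subr0 // => i _.
by rewrite L0 mxE mul0r.
Qed.

Theorem theorem1 (R : realType) (N Nx NT M : nat)
  (* balance law *)
  (I : set R) (Omega : set 'rV[R]_N)
  (F S Rs : 'rV[R]_N -> 'rV[R]_N) (H : R -> R) (Wstar : R -> 'rV[R]_N)
  (hI : is_interval I)
  (hOmega_open : open Omega)
  (hOmega_convex : convex_set (Omega : set (convex_lmodType 'rV[R]_N)))
  (hF : C1_on Omega F)
  (hH : [bounded H x | x in I])
  (hWstar : stationary_solution I Omega F S Rs H Wstar)
  (* mesh, time step *)
  (xl dx dt : R) (hdx : 0 < dx) (hdt : 0 < dt)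
  (hcells : I = \bigcup_(i in [set: 'I_Nx]) cell xl dx i)
  (* scheme and boundary rule *)
  (L : 'rV[R]_N -> 'rV[R]_N -> 'rV[R]_N -> 'rV[R]_N)
  (bl br : 'M[R]_(Nx, N) -> 'rV[R]_N)
  (hb : forall W : 'M[R]_(Nx, N), (forall i, Omega (row i W)) ->
          Omega (bl W) /\ Omega (br W))
  (* initial data *)
  (W1 : 'M[R]_(Nx, N))
  (hW1 : cell_averages xl dx Wstar W1 \/ midpoint_averages xl dx Wstar W1)
  (hW1_Omega : forall i, Omega (row i W1))
  (* the FOM is well-balanced for Wstar *)
  (hwb : forall n : nat, fom L bl br dt dx W1 n = W1)
  (* POD bases and number of retained modes *)
  (Phi : 'I_N -> 'M[R]_Nx)
  (hPhi : forall j : 'I_N,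
            pod_basis (snapshots (fom L bl br dt dx W1) NT j) (Phi j))
  (hM1 : (1 <= M)%N) (hMx : (M <= Nx)%N) (hMT : (M <= NT)%N) :
  forall n : nat,
    (forall i : 'I_Nx, Omega (row i (rom L bl br dt dx hMx Phi W1 n))) /\
    (forall (i : 'I_Nx) (j : 'I_N),
       rom L bl br dt dx hMx Phi W1 n i j = rom L bl br dt dx hMx Phi W1 0 i j /\
       rom L bl br dt dx hMx Phi W1 0 i j = W1 i j).
Proof.
(* At least one snapshot is taken; with none, [A A^T = 0] and any orthonormal basis would
   qualify. *)
have NT_gt0 := leq_trans hM1 hMT.
have snapE j : snapshots (fom L bl br dt dx W1) NT j = col j W1 *m const_mx 1.
  by apply/matrixP=> i n; rewrite !mxE hwb big_ord1 !mxE mulr1.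
have init_exact : rom_state hMx Phi (rom_init hMx Phi W1) = W1.
  apply: rom_state_init => [j | j k leMk]; first by case: (hPhi j).
  (* A discarded index satisfies [k >= M >= 1], so it is never the first mode. *)
  apply: (pod_basis_rank1 NT_gt0); last exact: leq_trans leMk.
  by rewrite -snapE.
(* A single unchanged time step suffices, since [dt / dx] can be cancelled. *)
have L0 := fom_step_fixed (lt0r_neq0 (divr_gt0 hdt hdx)) (hwb 1).
have rom_const n : rom L bl br dt dx hMx Phi W1 n = W1.
  rewrite /rom; suff -> : iter n (rom_step L bl br dt dx hMx Phi)
      (rom_init hMx Phi W1) = rom_init hMx Phi W1 by [].
  (* The initial coefficients reconstruct [W1] exactly, so the ROM evaluates [L] where [L0]
     applies. *)
  by elim: n => //= n ->; apply: rom_step_fixed; rewrite init_exact.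
by move=> n; split=> [i | i j]; rewrite !rom_const.
Qed.
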